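(* Let $k,n$ be natural numbers (possibly $0$) and let $\varphi$ be a first-order formula. Then the following hold: 1. $\varphi\in\mathcal{E}_k^n$ if and only if there exists $\psi\in\Sigma_k^+$ such that $\varphi \rightsquigarrow^*_n \psi$; 2. $\varphi\in\mathcal{U}_k^n$ if and only if there exists $\psi\in\Pi_k^+$ such that $\varphi \rightsquigarrow^*_n \psi$.
   Context: Formulas are those of a first-order language with logical constants $\forall,\exists,\to,\land,\lor,\perp$. $\mathrm{FV}(\varphi)$ is the set of free variables of $\varphi$. An overlined $\overline{x}$ is a non-empty list of variables; $\exists\overline{x}$ and $\forall\overline{x}$ are lists of quantifiers of the same kind. Prenex classes. $\Sigma_0=\Pi_0$ is the class of quantifier-free formulas; $\Sigma_{k+1}=\{\exists\overline{x}\,\varphi\mid\varphi\in\Pi_k\}$; $\Pi_{k+1}=\{\forall\overline{x}\,\varphi\mid\varphi\in\Sigma_k\}$. $\Sigma_k^+=\Sigma_k\cup\bigcup_{i<k}(\Sigma_i\cup\Pi_i)$ and $\Pi_k^+=\Pi_k\cup\bigcup_{i<k}(\Sigma_i\cup\Pi_i)$. A formula is in prenex normal form if it is in $\Sigma_k\cup\Pi_k$ for some $k$. Classes $\mathcal{E}^n_k,\mathcal{U}^n_k,\mathcal{D}^n_k$. For each $n$, $\mathcal{D}^n_0=\mathcal{E}^n_0=\mathcal{U}^n_0$ is the set of quantifier-free formulas. Given $\mathcal{E}^n_k$ and $\mathcal{U}^n_k$, put $\mathcal{D}^n_k=\mathcal{E}^n_k\cup\mathcal{U}^n_k$; then $\mathcal{E}^n_{k+1}$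 and $\mathcal{U}^n_{k+1}$ are simultaneously inductively generated by the following clauses, where $D$ ranges over $\mathcal{D}^n_k$, $E,E'$ over $\mathcal{E}^n_{k+1}$, and $U,U'$ over $\mathcal{U}^n_{k+1}$: - if $n>k$: $D,\ E\land E',\ E\lor E',\ U\to E,\ \exists xE\in\mathcal{E}^n_{k+1}$; and $D,\ U\land U',\ U\lor U',\ E\to U,\ \forall xU\in\mathcal{U}^n_{k+1}$; - if $n=k$: $D,\ E\land E',\ E\lor E',\ D\to E,\ \exists xE\in\mathcal{E}^n_{k+1}$; and $D,\ U\land U',\ U\lor D,\ D\lor U,\ E\to U,\ \forall xU\in\mathcal{U}^n_{k+1}$; - if $n<k$: with $D_0$ ranging over $\mathcal{D}^n_n$ and $E_1$ over $\mathcal{E}^n_{n+1}$: $D,\ E\land E',\ E\lor E_1,\ E_1\lor E,\ D_0\to E,\ \exists xE\in\mathcal{E}^n_{k+1}$; and $D,\ U\land U',\ U\lor D_0,\ D_0\lor U,\ E_1\to U,\ \forall xU\in\mathcal{U}^n_{k+1}$. Classes $\mathrm{E}_k^+,\mathrm{U}_k^+,\mathrm{C}_k^+$. An alternation path is a finite sequence in which the symbols $+$ and $-$ alternate; $l(s)$ is its length, $i(s)$ its first symbol (undefined, hence neither $+$ nor $-$, for the empty path $\langle\rangle$), and $s^\perp$ is $s$ with $+$ and $-$ switched. Define $\mathrm{Alt}(\varphi)$: if $\varphi$ is quantifier-free, $\mathrm{Alt}(\varphi)=\{\langle\rangle\}$; otherwise $\mathrm{Alt}(\varphi_1\land\varphi_2)=\mathrm{Alt}(\varphi_1\lor\varphi_2)=\mathrm{Alt}(\varphi_1)\cup\mathrm{Alt}(\varphi_2)$;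 $\mathrm{Alt}(\varphi_1\to\varphi_2)=\{s^\perp\mid s\in\mathrm{Alt}(\varphi_1)\}\cup\mathrm{Alt}(\varphi_2)$; $\mathrm{Alt}(\forall x\varphi_1)=\{s\in\mathrm{Alt}(\varphi_1)\mid i(s)=-\}\cup\{-s\mid s\in\mathrm{Alt}(\varphi_1),\,i(s)\neq-\}$; $\mathrm{Alt}(\exists x\varphi_1)=\{s\in\mathrm{Alt}(\varphi_1)\mid i(s)=+\}\cup\{+s\mid s\in\mathrm{Alt}(\varphi_1),\,i(s)\neq+\}$. Let $\deg(\varphi)=\max\{l(s)\mid s\in\mathrm{Alt}(\varphi)\}$, $\mathrm{F}_k=\{\varphi\mid\deg(\varphi)=k\}$, $\mathrm{E}_0=\mathrm{U}_0=\mathrm{F}_0$, $\mathrm{E}_{k+1}$ (resp. $\mathrm{U}_{k+1}$) the set of $\varphi\in\mathrm{F}_{k+1}$ such that $i(s)=+$ (resp. $i(s)=-$) for all $s\in\mathrm{Alt}(\varphi)$ with $l(s)=k+1$. Then $\mathrm{E}_k^+=\mathrm{E}_k\cup\bigcup_{i<k}\mathrm{F}_i$, $\mathrm{U}_k^+=\mathrm{U}_k\cup\bigcup_{i<k}\mathrm{F}_i$, $\mathrm{C}_k^+=\mathrm{E}_k^+\cup\mathrm{U}_k^+$. Relation $\rightsquigarrow^*_n$. $\varphi\rightsquigarrow^*_n\psi$ means that $\psi$ is obtained from $\varphi$ by finitely many (possibly zero) successive steps, each replacing a subformula occurrence, all of whose proper subformulas are in prenex normal form, according to one of the following rules (always $x\notin\mathrm{FV}(\delta)$,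 and $y$ does not appear in $\xi$): $(\exists\to)$: $\exists x\xi(x)\to\delta\rightsquigarrow\forall x(\xi(x)\to\delta)$; $(\forall\to)_n$ (available only if $n\neq0$): $\forall x\xi(x)\to\delta\rightsquigarrow\exists x(\xi(x)\to\delta)$, with $\xi(x)\in\mathrm{U}_n^+$; $(\to\exists)_n$: $\delta\to\exists x\xi(x)\rightsquigarrow\exists x(\delta\to\xi(x))$, with $\delta\in\mathrm{C}_n^+$; $(\to\forall)$: $\delta\to\forall x\xi(x)\rightsquigarrow\forall x(\delta\to\xi(x))$; for $Q\in\{\exists,\forall\}$: $Qx\xi(x)\land\delta\rightsquigarrow Qx(\xi(x)\land\delta)$ and $\delta\land Qx\xi(x)\rightsquigarrow Qx(\delta\land\xi(x))$; $(\exists\lor)$: $\exists x\xi(x)\lor\delta\rightsquigarrow\exists x(\xi(x)\lor\delta)$; $(\lor\exists)$: $\delta\lor\exists x\xi(x)\rightsquigarrow\exists x(\delta\lor\xi(x))$; $(\forall\lor)_n$: $\forall x\xi(x)\lor\delta\rightsquigarrow\forall x(\xi(x)\lor\delta)$, with $\delta\in\mathrm{C}_n^+$; $(\lor\forall)_n$: $\delta\lor\forall x\xi(x)\rightsquigarrow\forall x(\delta\lor\xi(x))$, with $\delta\in\mathrm{C}_n^+$; $(\exists\text{-var})$: $\exists x\xi(x)\rightsquigarrow\exists y\xi(y)$; $(\forall\text{-var})$: $\forall x\xi(x)\rightsquigarrow\forall y\xi(y)$. *)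

(* Defs.v *)
From mathcomp Require Import all_boot.
From Stdlib Require Import Relation_Operators.

Set Implicit Arguments.
Unset Strict Implicit.
Unset Printing Implicit Defensive.

(* Equality, if the language has it, is one of the relation symbols. *)
Record signature := Signature {
  fsym : Type;
  farity : fsym -> nat;
  rsym : Type;
  rarity : rsym -> nat
}.

Inductive term (L : signature) : Type :=
| Var of nat
| App (f : fsym L) of ('I_(farity f) -> term L).

(* Variables are named by natural numbers, also when bound: formulas are not
   identified up to renaming of bound variables. *)
Inductive form (L : signature) : Type :=
| Atom (r : rsym L) of ('I_(rarity r) -> term L)
| Bot
| And of form L & form L
| Or of form L & form L
| Imp of form L & form L
| All of nat & form L
| Ex of nat & form L.

Arguments Var {L}.
Arguments Bot {L}.

Fixpoint tvars (L : signature) (t : term L) : seq nat :=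
  match t with
  | Var x => [:: x]
  | App f a => flatten [seq tvars (a i) | i : 'I_(farity f)]
  end.

Fixpoint fv (L : signature) (p : form L) : seq nat :=
  match p with
  | Atom r a => flatten [seq tvars (a i) | i : 'I_(rarity r)]
  | Bot => [::]
  | And p1 p2 | Or p1 p2 | Imp p1 p2 => fv p1 ++ fv p2
  | All x p1 | Ex x p1 => [seq y <- fv p1 | y != x]
  end.

(* All variables that appear in p: free, bound, or next to a quantifier. *)
Fixpoint vars (L : signature) (p : form L) : seq nat :=
  match p with
  | Atom r a => flatten [seq tvars (a i) | i : 'I_(rarity r)]
  | Bot => [::]
  | And p1 p2 | Or p1 p2 | Imp p1 p2 => vars p1 ++ vars p2
  | All x p1 | Ex x p1 => x :: vars p1
  end.

Fixpoint trename (L : signature) (x y : nat) (t : term L) : term L :=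
  match t with
  | Var z => Var (if z == x then y else z)
  | App f a => App (fun i => trename x y (a i))
  end.

(* Replaces the free occurrences of x by y. Capture is not avoided: this is
   only used when y does not appear in p. *)
Fixpoint rename (L : signature) (x y : nat) (p : form L) : form L :=
  match p with
  | Atom r a => Atom (fun i => trename x y (a i))
  | Bot => Bot
  | And p1 p2 => And (rename x y p1) (rename x y p2)
  | Or p1 p2 => Or (rename x y p1) (rename x y p2)
  | Imp p1 p2 => Imp (rename x y p1) (rename x y p2)
  | All z p1 => All z (if z == x then p1 else rename x y p1)
  | Ex z p1 => Ex z (if z == x then p1 else rename x y p1)
  end.

Fixpoint qfree (L : signature) (p : form L) : bool :=
  match p with
  | Atom _ _ | Bot => true
  | And p1 p2 | Or p1 p2 | Imp p1 p2 => qfree p1 && qfree p2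
  | All _ _ | Ex _ _ => false
  end.

Fixpoint proper_subformula (L : signature) (q p : form L) : Prop :=
  match p with
  | Atom _ _ | Bot => False
  | And p1 p2 | Or p1 p2 | Imp p1 p2 =>
      (q = p1 \/ proper_subformula q p1) \/ (q = p2 \/ proper_subformula q p2)
  | All _ p1 | Ex _ p1 => q = p1 \/ proper_subformula q p1
  end.

Definition Exs (L : signature) (xs : seq nat) (p : form L) : form L :=
  foldr (@Ex L) p xs.

Definition Alls (L : signature) (xs : seq nat) (p : form L) : form L :=
  foldr (@All L) p xs.

Fixpoint Sigma (L : signature) (k : nat) (p : form L) : Prop :=
  match k with
  | 0 => qfree p
  | k'.+1 => exists xs q, xs <> [::] /\ Pi k' q /\ p = Exs xs q
  end
with Pi (L : signature) (k : nat) (p : form L) : Prop :=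
  match k with
  | 0 => qfree p
  | k'.+1 => exists xs q, xs <> [::] /\ Sigma k' q /\ p = Alls xs q
  end.

Definition Sigma_plus (L : signature) (k : nat) (p : form L) : Prop :=
  Sigma k p \/ exists i, i < k /\ (Sigma i p \/ Pi i p).

Definition Pi_plus (L : signature) (k : nat) (p : form L) : Prop :=
  Pi k p \/ exists i, i < k /\ (Sigma i p \/ Pi i p).

Definition prenex (L : signature) (p : form L) : Prop :=
  exists k, Sigma k p \/ Pi k p.

(* Level k.+1 refers only to levels k, n and n.+1, the last two when n < k,
   so generating all levels at once gives the same classes as generating them
   one after the other. Clauses shared by several of the cases n > k, n = k,
   n < k are merged. *)
Inductive classE (L : signature) (n : nat) : nat -> form L -> Prop :=
| E_qfree p : qfree p -> classE n 0 p
| E_D k p : classD n k p -> classE n k.+1 p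
| E_and k p q : classE n k.+1 p -> classE n k.+1 q -> classE n k.+1 (And p q)
| E_ex k x p : classE n k.+1 p -> classE n k.+1 (Ex x p)
| E_or_ge k p q : k <= n ->
    classE n k.+1 p -> classE n k.+1 q -> classE n k.+1 (Or p q)
| E_imp_gt k p q : k < n ->
    classU n k.+1 p -> classE n k.+1 q -> classE n k.+1 (Imp p q)
| E_imp_eq k p q : n = k ->
    classD n k p -> classE n k.+1 q -> classE n k.+1 (Imp p q)
| E_or_lt_r k p q : n < k ->
    classE n k.+1 p -> classE n n.+1 q -> classE n k.+1 (Or p q)
| E_or_lt_l k p q : n < k ->
    classE n n.+1 p -> classE n k.+1 q -> classE n k.+1 (Or p q)
| E_imp_lt k p q : n < k ->
    classD n n p -> classE n k.+1 q -> classE n k.+1 (Imp p q)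
with classU (L : signature) (n : nat) : nat -> form L -> Prop :=
| U_qfree p : qfree p -> classU n 0 p
| U_D k p : classD n k p -> classU n k.+1 p
| U_and k p q : classU n k.+1 p -> classU n k.+1 q -> classU n k.+1 (And p q)
| U_all k x p : classU n k.+1 p -> classU n k.+1 (All x p)
| U_or_gt k p q : k < n ->
    classU n k.+1 p -> classU n k.+1 q -> classU n k.+1 (Or p q)
| U_imp_ge k p q : k <= n ->
    classE n k.+1 p -> classU n k.+1 q -> classU n k.+1 (Imp p q)
| U_or_eq_r k p q : n = k ->
    classU n k.+1 p -> classD n k q -> classU n k.+1 (Or p q)
| U_or_eq_l k p q : n = k ->
    classD n k p -> classU n k.+1 q -> classU n k.+1 (Or p q)
| U_or_lt_r k p q : n < k ->
    classU n k.+1 p -> classD n n q -> classU n k.+1 (Or p q)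
| U_or_lt_l k p q : n < k ->
    classD n n p -> classU n k.+1 q -> classU n k.+1 (Or p q)
| U_imp_lt k p q : n < k ->
    classE n n.+1 p -> classU n k.+1 q -> classU n k.+1 (Imp p q)
with classD (L : signature) (n : nat) : nat -> form L -> Prop :=
| D_E k p : classE n k p -> classD n k p
| D_U k p : classU n k p -> classD n k p.

(* Alternation paths: true stands for + and false for -. *)
Definition altpath := seq bool.

Definition first (s : altpath) : option bool := ohead s.

Definition flip (s : altpath) : altpath := map negb s.

Definition extend (b : bool) (s : altpath) : altpath :=
  if first s == Some b then s else b :: s.

(* The finite set Alt(p), as a list; only membership in it matters. *)
Fixpoint Alt (L : signature) (p : form L) : seq altpath :=
  if qfree p then [:: [::]] else
  match p with
  | Atom _ _ | Bot => [:: [::]] (* not reached *)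
  | And p1 p2 | Or p1 p2 => Alt p1 ++ Alt p2
  | Imp p1 p2 => map flip (Alt p1) ++ Alt p2
  | All _ p1 => map (extend false) (Alt p1)
  | Ex _ p1 => map (extend true) (Alt p1)
  end.

Definition deg (L : signature) (p : form L) : nat := \max_(s <- Alt p) size s.

Definition F (L : signature) (k : nat) (p : form L) : Prop := deg p = k.

Definition E (L : signature) (k : nat) (p : form L) : Prop :=
  F k p /\
  (0 < k -> forall s, s \in Alt p -> size s = k -> first s = Some true).

Definition U (L : signature) (k : nat) (p : form L) : Prop :=
  F k p /\
  (0 < k -> forall s, s \in Alt p -> size s = k -> first s = Some false).

Definition E_plus (L : signature) (k : nat) (p : form L) : Prop :=
  E k p \/ exists i, i < k /\ F i p.

Definition U_plus (L : signature) (k : nat) (p : form L) : Prop :=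
  U k p \/ exists i, i < k /\ F i p.

Definition C_plus (L : signature) (k : nat) (p : form L) : Prop :=
  E_plus k p \/ U_plus k p.

Inductive rule (L : signature) (n : nat) : form L -> form L -> Prop :=
| ex_imp x xi d : x \notin fv d ->
    rule n (Imp (Ex x xi) d) (All x (Imp xi d))
| all_imp x xi d : x \notin fv d -> n <> 0 -> U_plus n xi ->
    rule n (Imp (All x xi) d) (Ex x (Imp xi d))
| imp_ex x xi d : x \notin fv d -> C_plus n d ->
    rule n (Imp d (Ex x xi)) (Ex x (Imp d xi))
| imp_all x xi d : x \notin fv d ->
    rule n (Imp d (All x xi)) (All x (Imp d xi))
| ex_and x xi d : x \notin fv d ->
    rule n (And (Ex x xi) d) (Ex x (And xi d))
| all_and x xi d : x \notin fv d ->
    rule n (And (All x xi) d) (All x (And xi d))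
| and_ex x xi d : x \notin fv d ->
    rule n (And d (Ex x xi)) (Ex x (And d xi))
| and_all x xi d : x \notin fv d ->
    rule n (And d (All x xi)) (All x (And d xi))
| ex_or x xi d : x \notin fv d ->
    rule n (Or (Ex x xi) d) (Ex x (Or xi d))
| or_ex x xi d : x \notin fv d ->
    rule n (Or d (Ex x xi)) (Ex x (Or d xi))
| all_or x xi d : x \notin fv d -> C_plus n d ->
    rule n (Or (All x xi) d) (All x (Or xi d))
| or_all x xi d : x \notin fv d -> C_plus n d ->
    rule n (Or d (All x xi)) (All x (Or d xi))
| ex_var x y xi : y \notin vars xi ->
    rule n (Ex x xi) (Ex y (rename x y xi))
| all_var x y xi : y \notin vars xi ->
    rule n (All x xi) (All y (rename x y xi)).

Inductive step (L : signature) (n : nat) : form L -> form L -> Prop :=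
| step_here p p' : (forall q, proper_subformula q p -> prenex q) ->
    rule n p p' -> step n p p'
| step_and_l p p' q : step n p p' -> step n (And p q) (And p' q)
| step_and_r p q q' : step n q q' -> step n (And p q) (And p q')
| step_or_l p p' q : step n p p' -> step n (Or p q) (Or p' q)
| step_or_r p q q' : step n q q' -> step n (Or p q) (Or p q')
| step_imp_l p p' q : step n p p' -> step n (Imp p q) (Imp p' q)
| step_imp_r p q q' : step n q q' -> step n (Imp p q) (Imp p q')
| step_all x p p' : step n p p' -> step n (All x p) (All x p')
| step_ex x p p' : step n p p' -> step n (Ex x p) (Ex x p').

Definition steps (L : signature) (n : nat) : form L -> form L -> Prop :=
  clos_refl_trans (form L) (@step L n).

(* Main.v *)
Require Import Defs.
From mathcomp Require Import all_boot zify.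
From Stdlib Require Import Relation_Operators.

Set Implicit Arguments.
Unset Strict Implicit.
Unset Printing Implicit Defensive.

(* Every step is invertible for membership in the classes: once the mutual
   induction is unfolded, membership of a compound formula in a class is a
   boolean condition on memberships of its immediate subformulas, and the side
   conditions of the rules are what makes this condition insensitive to pulling
   a quantifier out. Since the classes restricted to prenex formulas are
   Sigma_k^+ and Pi_k^+, this gives one direction.
   For the other direction, two prenex operands of a connective are merged one
   quantifier at a time. If the compound formula is in the class of level k+1
   and polarity b, then either some operand starts with a quantifier that a rule
   may turn into an outer quantifier of polarity b without leaving the class, or
   the compound formula already is in the class of level k and the opposite
   polarity. *)

(** * A Boolean form of membership in the classes *)

Section Classes.

Variables (L : signature) (n : nat).
Implicit Types (p q : form L) (b : bool) (k x y : nat).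

(* [cls true k] is the class E^n_k and [cls false k] the class U^n_k. The
   disjuncts guarded by [n.+1 < k] account for formulas that enter through level
   [k.-1] of the opposite polarity only. *)
Fixpoint cls b k p : bool :=
  match p with
  | Atom _ _ | Bot => true
  | And p1 p2 => cls b k p1 && cls b k p2
  | Or p1 p2 =>
      if k <= n then cls b k p1 && cls b k p2
      else
        let m := if b then k else k.-1 in
        let viaE := (cls true m p1 && cls true n.+1 p2)
                    || (cls true n.+1 p1 && cls true m p2) in
        if b then viaE
        else [|| cls false k p1 && (cls true n p2 || cls false n p2),
                 (cls true n p1 || cls false n p1) && cls false k p2
               | (n.+1 < k) && viaE]
  | Imp p1 p2 =>
      if k <= n then cls (~~ b) k p1 && cls b k p2
      else if b then (cls true n p1 || cls false n p1) && cls true k p2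
           || (n.+1 < k) && (cls true n.+1 p1 && cls false k.-1 p2)
      else cls true n.+1 p1 && cls false k p2
  | All _ p1 => if b then (1 < k) && cls false k.-1 p1
                else (0 < k) && cls false k p1
  | Ex _ p1 => if b then (0 < k) && cls true k p1
               else (1 < k) && cls true k.-1 p1
  end.

Definition dcls k p := cls true k p || cls false k p.

Lemma cls0 b p : cls b 0 p = qfree p.
Proof.
elim: p b => //=.
- by move=> p1 IH1 p2 IH2 b; rewrite IH1 IH2.
- by move=> p1 IH1 p2 IH2 b; rewrite IH1 IH2.
- by move=> p1 IH1 p2 IH2 b; rewrite IH1 IH2.
- by move=> x p IH [].
- by move=> x p IH [].
Qed.

Lemma cls_qfree b k p : qfree p -> cls b k p.
Proof.
elim: p b k => //= p1 IH1 p2 IH2 b k /andP[q1 q2].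
- by rewrite IH1 ?IH2.
- by rewrite !IH1 ?IH2 //; case: b; case: ifP.
- by rewrite !IH1 ?IH2 //; case: b; case: ifP.
Qed.

(** [cls] recurses on the formula, so the clauses that let all of level [k] into level [k.+1] have
    to be shown admissible for it. The delicate case is [k = n], where the condition on disjunctions
    and implications changes shape. *)
Lemma clsS b b' k p : cls b k p -> cls b' k.+1 p.
Proof.
elim: p b b' k => //.
- by move=> p1 IH1 p2 IH2 b b' k /= /andP[/IH1-> /IH2->].
- move=> p1 IH1 p2 IH2 b b' k /=.
  have S1 := IH1 _ _ _; have S2 := IH2 _ _ _.
  have [le_kn|lt_nk] := leqP k n.
    move=> /andP[c1 c2]; have [lt_kn|le_nk] := leqP k.+1 n.
      by rewrite (S1 _ _ _ c1) (S2 _ _ _ c2).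
    have Ek : k = n by lia.
    subst k; case: b' => /=; first by rewrite (S1 _ _ _ c1) (S2 _ _ _ c2).
    (* Passing from level [n] to [n.+1], one disjunct is raised and the other stays at level [n], as
       the universal clause asks. *)
    rewrite (S1 _ _ _ c1); case: b c1 c2 => c1 c2; by rewrite c2 ?orbT.
  rewrite (ltnNge k n) (ltnW lt_nk) /=.
  case: b b' => [] [] /=.
  + by case/orP=> /andP[]; [move=> /S1-> -> | move=> -> /S2->]; rewrite ?orbT.
  + by move=> ->; rewrite ltnS lt_nk !orbT.
  + case/or3P => [/andP[/S1-> h]|/andP[h /S2->]|].
    * by case/orP: h => /S2->.
    * by rewrite andbT; case/orP: h => /S1->; rewrite orbT.
    * case: k lt_nk => //= k lt_nk /andP[_ /orP[/andP[c ->]|/andP[-> c]]].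
        by rewrite (S1 _ _ _ (S1 _ true _ c)).
      by rewrite (S2 _ _ _ (S2 _ true _ c)) orbT.
  + case/or3P => [/andP[/S1-> ->]|/andP[-> /S2->]|]; rewrite ?orbT //.
    case: k lt_nk => //= k lt_nk /andP[lt].
    rewrite (ltnW lt : n.+1 < k.+2).
    by case/orP=> /andP[]; [move=> /S1-> -> | move=> -> /S2->]; rewrite ?orbT.
- move=> p1 IH1 p2 IH2 b b' k /=.
  have S1 := IH1 _ _ _; have S2 := IH2 _ _ _.
  have [le_kn|lt_nk] := leqP k n.
    move=> /andP[c1 c2]; have [lt_kn|le_nk] := leqP k.+1 n.
      by rewrite (S1 _ _ _ c1) (S2 _ _ _ c2).
    have Ek : k = n by lia.
    subst k; case: b' => /=; last by rewrite (S1 _ _ _ c1) (S2 _ _ _ c2).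
    rewrite (S2 _ _ _ c2); case: b c1 c2 => c1 c2; by rewrite c1 ?orbT.
  rewrite (ltnNge k n) (ltnW lt_nk) /=.
  case: b b' => [] [] /=.
  + case/orP=> [/andP[-> /S2->] //|].
    case: k lt_nk => //= k lt_nk /andP[lt /andP[-> /S2->]].
    by rewrite (ltnW lt : n.+1 < k.+2) orbT.
  + case/orP=> [/andP[h /S2->]|]; first by case/orP: h => /S1->.
    by case: k lt_nk => //= k lt_nk /andP[lt /andP[-> /(S2 _ true) /S2->]].
  + by rewrite ltnS lt_nk => ->; rewrite orbT.
  + by move=> /andP[-> /S2->].
- move=> x p IH b b' k /=; case: b b' => [] [] /=.
  + by case: k => //= k /andP[_ /IH->].
  + by case: k => //= k /andP[k0 /(IH _ true) /IH->].
  + by rewrite ltnS.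
  + by move=> /andP[_ /IH->].
- move=> x p IH b b' k /=; case: b b' => [] [] /=.
  + by move=> /andP[_ /IH->].
  + by rewrite ltnS.
  + by case: k => //= k /andP[k0 /(IH _ true) /IH->].
  + by case: k => //= k /andP[_ /IH->].
Qed.

Lemma cls_lt b b' k m p : k < m -> cls b k p -> cls b' m p.
Proof.
elim: m b' => // m IH b'; rewrite ltnS leq_eqVlt => /orP[/eqP->|lt c].
  exact: clsS.
exact: clsS (IH true lt c).
Qed.

Lemma cls_le b k m p : k <= m -> cls b k p -> cls b m p.
Proof. by rewrite leq_eqVlt => /orP[/eqP->|] //; apply: cls_lt. Qed.

Lemma dcls_le b k m p : k <= m -> cls b k p -> dcls m p.
Proof.
by move=> le /(cls_le le); rewrite /dcls; case: b => ->; rewrite ?orbT.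
Qed.

Lemma dcls_lt b k m p : k < m -> dcls k p -> cls b m p.
Proof. by move=> lt /orP[]; apply: cls_lt. Qed.

Scheme classE_mind := Minimality for classE Sort Prop
  with classU_mind := Minimality for classU Sort Prop
  with classD_mind := Minimality for classD Sort Prop.
Combined Scheme class_mind from classE_mind, classU_mind, classD_mind.

(** The clauses for [n = k] and for [n < k] fit one condition of [cls], since for [k = n] the levels
    [k.+1] and [n.+1] coincide. The [D] clauses are cumulativity. *)
Lemma class_cls :
  (forall k p, classE n k p -> cls true k p) /\
  (forall k p, classU n k p -> cls false k p) /\
  (forall k p, classD n k p -> dcls k p).
Proof.
apply: (@class_mind L n (fun k p => cls true k p) (fun k p => cls false k p)
          (fun k p => dcls k p)) => /=.
- by move=> p; apply: cls_qfree.
- by move=> k p _; apply: dcls_lt.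
- by move=> k p q _ -> _ ->.
- by [].
- move=> k p q le _ c1 _ c2; case: ifP => [_|]; first by rewrite c1 c2.
  move=> lt; have -> : n.+1 = k.+1 by lia.
  by rewrite c1 c2.
- by move=> k p q -> _ -> _ ->.
- move=> k p q <- _ c1 _ c2; rewrite ltnn.
  by rewrite -/(dcls n p) c1 c2.
- by move=> k p q lt _ c1 _ c2; rewrite ltnNge (ltnW lt) /= c1 c2.
- by move=> k p q lt _ c1 _ c2; rewrite ltnNge (ltnW lt) /= c1 c2 orbT.
- by move=> k p q lt _ c1 _ c2; rewrite ltnNge (ltnW lt) /= -/(dcls n p) c1 c2.
- by move=> p; apply: cls_qfree.
- by move=> k p _; apply: dcls_lt.
- by move=> k p q _ -> _ ->.
- by [].
- by move=> k p q -> _ -> _ ->.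
- move=> k p q le _ c1 _ c2; case: ifP => [_|]; first by rewrite c1 c2.
  move=> lt; have -> : n.+1 = k.+1 by lia.
  by rewrite c1 c2.
- by move=> k p q <- _ c1 _ c2; rewrite ltnn c1 -/(dcls n q) c2.
- by move=> k p q <- _ c1 _ c2; rewrite ltnn c2 -/(dcls n p) c1 orbT.
- by move=> k p q lt _ c1 _ c2; rewrite ltnNge (ltnW lt) /= c1 -/(dcls n q) c2.
- by move=> k p q lt _ c1 _ c2;
    rewrite ltnNge (ltnW lt) /= -/(dcls n p) c1 c2 orbT.
- by move=> k p q lt _ c1 _ c2; rewrite ltnNge (ltnW lt) /= c1 c2.
- by move=> k p _; rewrite /dcls => ->.
- by move=> k p _; rewrite /dcls => ->; rewrite orbT.
Qed.

Definition class b := if b then @classE L n else @classU L n.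

Lemma class_qfree b k p : qfree p -> class b k p.
Proof.
move=> qp; elim: k b => [|k IH] [] /=; try by constructor.
  by constructor; constructor; apply: (IH true).
by constructor; constructor; apply: (IH true).
Qed.

Lemma classS b b' k p : class b k p -> class b' k.+1 p.
Proof. by case: b b' => [] [] /= c; constructor; by constructor. Qed.

Lemma dcls_classD k p :
  (forall b k, cls b k p -> class b k p) -> dcls k p -> classD n k p.
Proof. by move=> IH /orP[] /IH; constructor. Qed.

(** This serves twice: for existential disjunctions, and one level lower for universal classes that
    such a disjunction enters by cumulativity. *)
Lemma class_or_E k p q : n < k ->
  (forall b k, cls b k p -> class b k p) ->
  (forall b k, cls b k q -> class b k q) ->
  cls true k p && cls true n.+1 q || cls true n.+1 p && cls true k q ->
  classE n k (Or p q).
Proof.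
case: k => // k lt IH1 IH2.
have [/eqP E|lt'] : (k == n) \/ n < k by lia.
  subst k; rewrite orbb => /andP[/IH1 c1 /IH2 c2]; exact: E_or_ge.
by case/orP => /andP[/IH1 c1 /IH2 c2]; [apply: E_or_lt_r | apply: E_or_lt_l].
Qed.

Lemma cls_class b k p : cls b k p -> class b k p.
Proof.
elim: p b k.
- by move=> r a b k _; apply: class_qfree.
- by move=> b k _; apply: class_qfree.
- move=> p1 IH1 p2 IH2 b [|k]; first by rewrite cls0; apply: class_qfree.
  by move=> /= /andP[/IH1 c1 /IH2 c2]; case: b c1 c2; constructor.
- move=> p1 IH1 p2 IH2 b [|k]; first by rewrite cls0; apply: class_qfree.
  rewrite /=; have [le|gt] := ltnP.
    move=> /andP[/IH1 c1 /IH2 c2]; case: b c1 c2 => /= c1 c2.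
      by apply: E_or_ge => //; apply: ltnW.
    exact: U_or_gt.
  case: b => /=; first exact: class_or_E.
  rewrite -/(dcls n p1) -/(dcls n p2) => /or3P[].
  + move=> /andP[/IH1 c1 /(dcls_classD IH2) c2].
    have [/eqP E|lt'] : (n == k) \/ n < k by lia.
      by apply: U_or_eq_r => //; subst.
    exact: U_or_lt_r.
  + move=> /andP[/(dcls_classD IH1) c1 /IH2 c2].
    have [/eqP E|lt'] : (n == k) \/ n < k by lia.
      by apply: U_or_eq_l => //; subst.
    exact: U_or_lt_l.
  + by move=> /andP[lt /(class_or_E lt IH1 IH2) c]; do 2!constructor.
- move=> p1 IH1 p2 IH2 b [|k]; first by rewrite cls0; apply: class_qfree.
  rewrite /=; have [le|gt] := ltnP.
    move=> /andP[/IH1 c1 /IH2 c2]; case: b c1 c2 => /= c1 c2.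
      exact: E_imp_gt.
    by apply: U_imp_ge => //; apply: ltnW.
  have [/eqP E|lt] : (n == k) \/ n < k by lia.
    subst k; rewrite ltnn /= orbF -/(dcls n p1); case: b.
      by move=> /andP[/(dcls_classD IH1) c1 /IH2 c2]; apply: E_imp_eq.
    by move=> /andP[/IH1 c1 /IH2 c2]; apply: U_imp_ge.
  case: b; last by move=> /andP[/IH1 c1 /IH2 c2]; apply: U_imp_lt.
  rewrite -/(dcls n p1); case/orP.
    by move=> /andP[/(dcls_classD IH1) c1 /IH2 c2]; apply: E_imp_lt.
  move=> /andP[_ /andP[/IH1 c1 /IH2 c2]].
  (* The implication is universal one level lower and is raised from there. *)
  apply: (@classS false true); case: k gt lt c2 => // k gt lt c2.
  have [/eqP E|lt'] : (n == k) \/ n < k by lia.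
    by subst k; apply: U_imp_ge.
  exact: U_imp_lt.
- move=> x p IH [] [|k] //=.
    case: k => //= k /IH c; apply: (@classS false true); exact: U_all.
  by move=> /IH c; apply: U_all.
- move=> x p IH [] [|k] //=.
    by move=> /IH c; apply: E_ex.
  case: k => //= k /IH c; apply: (@classS true false); exact: E_ex.
Qed.

Lemma classE_cls k p : classE n k p <-> cls true k p.
Proof. by split; [apply: class_cls.1 | apply: (@cls_class true)]. Qed.

Lemma classU_cls k p : classU n k p <-> cls false k p.
Proof. by split; [apply: class_cls.2.1 | apply: (@cls_class false)]. Qed.


(** * Prenex formulas, read through the blocks of their prefix *)

(* [true] is the existential polarity, as in [altpath]. *)
Definition Qu b x p := if b then Ex x p else All x p.

Fixpoint prenexb p : bool :=
  match p with All _ p1 | Ex _ p1 => prenexb p1 | _ => qfree p end.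

(** On a prenex formula this is its only alternation path, with one symbol per block of like
    quantifiers. *)
Fixpoint prefix_path p : altpath :=
  match p with
  | All _ p1 => extend false (prefix_path p1)
  | Ex _ p1 => extend true (prefix_path p1)
  | _ => [::]
  end.

Lemma pren_qfree p : qfree p -> prenexb p.
Proof. by case: p. Qed.

Lemma path_qfree p : qfree p -> prefix_path p = [::].
Proof. by case: p. Qed.

Lemma path_nil p : prenexb p -> size (prefix_path p) = 0 -> qfree p.
Proof.
by case: p => //= x p _; rewrite /extend; case: ifP; case: (prefix_path p).
Qed.

Lemma pren_Qu b x p : prenexb (Qu b x p) = prenexb p.
Proof. by case: b. Qed.

Lemma path_Qu b x p : prefix_path (Qu b x p) = extend b (prefix_path p).
Proof. by case: b. Qed.

Lemma prenP p :
  prenexb p -> qfree p \/ exists b x p1, p = Qu b x p1 /\ prenexb p1.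
Proof.
by case: p => /=; auto => x p1 h; right; [exists false | exists true];
  exists x, p1.
Qed.

Lemma pren_ind (P : form L -> Prop) :
  (forall p, qfree p -> P p) ->
  (forall b x p, prenexb p -> P p -> P (Qu b x p)) ->
  forall p, prenexb p -> P p.
Proof.
move=> H0 HQ; elim=> /=; try by move=> *; apply: H0.
  by move=> x p IH h; apply: (HQ false) => //; apply: IH.
by move=> x p IH h; apply: (HQ true) => //; apply: IH.
Qed.

Lemma Alt_pren p : prenexb p -> Alt p = [:: prefix_path p].
Proof.
move: p; apply: pren_ind => [p qp|b x p _ IH].
  by rewrite path_qfree //; case: p qp => //= p q ->.
by case: b => /=; rewrite IH.
Qed.

Definition at_level b k (s : altpath) :=
  (size s == k) && ((k == 0) || (first s == Some b)).

(** In a prenex formula connectives occur only in the quantifier-free matrix, so only the quantifier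
    clauses of [cls] matter; these count blocks and do not mention [n]. *)
Lemma cls_path b k p :
  prenexb p ->
  cls b k p = (size (prefix_path p) < k) || at_level b k (prefix_path p).
Proof.
rewrite /at_level => hp; move: p hp b k; apply: pren_ind => [p qp|c x p _ IH] b k.
  by rewrite cls_qfree ?path_qfree //=; case: k.
have -> : cls b k (Qu c x p) =
    if b == c then (0 < k) && cls b k p else (1 < k) && cls c k.-1 p.
  by case: b c => [] [].
rewrite path_Qu /extend !IH; case: (prefix_path p) => [|a s] /=.
  by case: k => [|[|k]]; case: b c => [] [].
have eqS u v : (Some u == Some v) = ~~ (u (+) v) by case: u; case: v.
by case: a b c => [] [] [] /=; rewrite ?eqS /=; lia.
Qed.

Lemma Exs_pren xs p : prenexb (Exs xs p) = prenexb p.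
Proof. by elim: xs. Qed.

Lemma Alls_pren xs p : prenexb (Alls xs p) = prenexb p.
Proof. by elim: xs. Qed.

Lemma Sigma_Pi_path k p :
  (Sigma k p <-> prenexb p && at_level true k (prefix_path p)) /\
  (Pi k p <-> prenexb p && at_level false k (prefix_path p)).
Proof.
elim: k p => [|k IH] p.
  rewrite /at_level /= andbT.
  suff: qfree p <-> prenexb p && (size (prefix_path p) == 0) by [].
  split=> [qp|/andP[? /eqP]]; first by rewrite pren_qfree // path_qfree.
  exact: path_nil.
(* A non-empty block of polarity [b] adds exactly one symbol, because a path at level [k] of
   polarity [~~ b] does not start with [b]. *)
have aux b c s (xs : seq nat) : c = ~~ b -> xs <> [::] -> at_level c k s ->
    at_level b k.+1 (foldr (fun _ => extend b) s xs).
  move=> -> nz /andP[/eqP Es fs].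
  have {}fs : first s <> Some b.
    move=> E; move: fs; rewrite E; case: s Es E => //= a s <- _ /=.
    by case: b.
  elim: xs nz => //= x xs IHx _.
  have [E|/eqP nz] := boolP (xs == [::]).
    rewrite (eqP E) /= /extend; case: eqP => //= _.
    by rewrite /at_level /= Es !eqxx.
  by have /andP[h1 h2] := IHx nz; rewrite {1}/extend (h2 : first _ == _); apply/andP.
have pE xs q : prefix_path (Exs xs q) =
    foldr (fun _ => extend true) (prefix_path q) xs.
  by elim: xs => //= x xs ->.
have pA xs q : prefix_path (Alls xs q) =
    foldr (fun _ => extend false) (prefix_path q) xs.
  by elim: xs => //= x xs ->.
split; split.
- move=> [xs [q [nz [/(IH q).2 /andP[pq lq] ->]]]].
  by rewrite Exs_pren pq pE; apply: aux nz lq.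
- move=> /andP[pp]; move: p pp; apply: pren_ind => [p qp|b x p pp IHp].
    by rewrite path_qfree.
  rewrite path_Qu /at_level /= {1 2}/extend.
  (* If the path below starts with [b], the quantifier joins the block found by induction; otherwise
     it forms a block of its own. *)
  case: (boolP (first (prefix_path p) == Some b)) => fp.
    case: b fp => // fp => [h|]; last by rewrite (eqP fp) andbF.
    have [|xs [q [nz [Pq ->]]]] := IHp; first by rewrite /at_level.
    by exists (x :: xs), q.
  case: b fp => fp; last by rewrite andbF.
  rewrite /= eqSS ?eqxx ?andbT => sk.
  exists [:: x], p; do 2!split => //; apply/(IH p).2; rewrite pp /at_level sk /=.
  by case: (prefix_path p) sk fp => [|[] s] /eqP <-.
- move=> [xs [q [nz [/(IH q).1 /andP[pq lq] ->]]]].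
  by rewrite Alls_pren pq pA; apply: aux nz lq.
- move=> /andP[pp]; move: p pp; apply: pren_ind => [p qp|b x p pp IHp].
    by rewrite path_qfree.
  rewrite path_Qu /at_level /= {1 2}/extend.
  case: (boolP (first (prefix_path p) == Some b)) => fp.
    case: b fp => // fp => [|h]; first by rewrite (eqP fp) andbF.
    have [|xs [q [nz [Pq ->]]]] := IHp; first by rewrite /at_level.
    by exists (x :: xs), q.
  case: b fp => fp; first by rewrite andbF.
  rewrite /= eqSS ?eqxx ?andbT => sk.
  exists [:: x], p; do 2!split => //; apply/(IH p).1; rewrite pp /at_level sk /=.
  by case: (prefix_path p) sk fp => [|[] s] /eqP <-.
Qed.

Lemma Sigma_or_Pi_path k p :
  Sigma k p \/ Pi k p <-> prenexb p /\ size (prefix_path p) = k.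
Proof.
have [hS hP] := Sigma_Pi_path k p; split.
  by case=> [/hS|/hP] /andP[-> /andP[/eqP -> _]].
move=> [pp sk]; rewrite /at_level in hS hP.
case E: (prefix_path p) sk => [|[] s] /= sk;
  [left; apply/hS|left; apply/hS|right; apply/hP];
  by rewrite pp E -sk /= ?eqxx.
Qed.

Lemma prenex_pren p : prenex p <-> prenexb p.
Proof.
split=> [[k /Sigma_or_Pi_path[]]//|pp].
by exists (size (prefix_path p)); apply/Sigma_or_Pi_path.
Qed.

Lemma Sigma_plus_cls k p : Sigma_plus k p <-> prenexb p && cls true k p.
Proof.
split.
  case=> [/(Sigma_Pi_path k p).1/andP[pp lp]|[i [lt /Sigma_or_Pi_path[pp E]]]].
    by rewrite pp cls_path // lp orbT.
  by rewrite pp cls_path // E lt.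
move=> /andP[pp]; rewrite cls_path // => /orP[lt|lp].
  by right; exists (size (prefix_path p)); split=> //; apply/Sigma_or_Pi_path.
by left; apply/(Sigma_Pi_path k p).1; rewrite pp.
Qed.

Lemma Pi_plus_cls k p : Pi_plus k p <-> prenexb p && cls false k p.
Proof.
split.
  case=> [/(Sigma_Pi_path k p).2/andP[pp lp]|[i [lt /Sigma_or_Pi_path[pp E]]]].
    by rewrite pp cls_path // lp orbT.
  by rewrite pp cls_path // E lt.
move=> /andP[pp]; rewrite cls_path // => /orP[lt|lp].
  by right; exists (size (prefix_path p)); split=> //; apply/Sigma_or_Pi_path.
by left; apply/(Sigma_Pi_path k p).2; rewrite pp.
Qed.

Lemma deg_pren p : prenexb p -> deg p = size (prefix_path p).
Proof. by move=> pp; rewrite /deg Alt_pren // big_seq1. Qed.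

(** The left side is the common unfolding of [E_plus] and [U_plus]. As there is a single alternation
    path, both the degree and the condition on longest paths are read off it. *)
Lemma plus_path b k p : prenexb p ->
  (F k p /\ (0 < k -> forall s, s \in Alt p -> size s = k -> first s = Some b))
  \/ (exists i, i < k /\ F i p) <-> cls b k p.
Proof.
move=> pp; rewrite cls_path // /F deg_pren // Alt_pren //; split.
  case=> [[E h]|[i [lt ->]]]; last by rewrite lt.
  rewrite /at_level E eqxx; case: k E h => [|k] E h; first by rewrite orbT.
  by rewrite (h isT _ (mem_head _ _) E) /= eqxx orbT.
case/orP=> [lt|/andP[/eqP E h]]; first by right; exists (size (prefix_path p)).
left; split=> // k0 s; rewrite inE => /eqP -> _; apply/eqP.
by move: h; rewrite eqn0Ngt k0.
Qed.

(** A rule applies only where all proper subformulas are prenex, so its side conditions can be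
    expressed by [cls] at level [n]. *)
Lemma U_plus_cls p : prenexb p -> U_plus n p <-> cls false n p.
Proof. exact: plus_path. Qed.

Lemma C_plus_cls p : prenexb p -> C_plus n p <-> dcls n p.
Proof.
move=> pp; rewrite /C_plus /dcls; split.
  by case=> /(plus_path _ _ pp) ->; rewrite ?orbT.
by case/orP => h; [left | right]; apply/(plus_path _ _ pp).
Qed.

(** * Class membership is inherited backwards along steps *)

Lemma cls_rename b k x y p : cls b k (rename x y p) = cls b k p.
Proof.
elim: p b k => //= [p1 IH1 p2 IH2|p1 IH1 p2 IH2|p1 IH1 p2 IH2|z p IH|z p IH] b k;
  by rewrite ?IH1 ?IH2 //; case: eqP; rewrite ?IH.
Qed.

Lemma cls_Qu b c k x p :
  cls b k (Qu c x p) =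
  if b == c then (0 < k) && cls b k p else (1 < k) && cls c k.-1 p.
Proof. by case: b c => [] []. Qed.

(** Only classes of the polarity [c] of the pulled quantifier need study: for the other polarity the
    formula lies one level lower in a class of polarity [c], and the result is raised. *)
Lemma cls_Qu_intro b c k x p q :
  (forall m, 0 < m -> cls c m p -> cls c m q) ->
  cls b k (Qu c x p) -> cls b k q.
Proof.
move=> H; rewrite cls_Qu; case: eqP => [->|_] /andP[k0 cp]; first exact: H.
by case: k k0 cp => [|k] //= k0 /(H k k0); apply: cls_lt.
Qed.

(** Above level [n] the hypothesis supplies the condition on [p], and only [q] has to be placed; if
    the implication came from level [m.-1], [q] is raised. The two lemmas on disjunctions below work
    alike. *)
Lemma cls_imp_exR b k x p q :
  dcls n p -> cls b k (Ex x (Imp p q)) -> cls b k (Imp p (Ex x q)).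
Proof.
move=> dp; apply: (@cls_Qu_intro b true) => m m0 /=; rewrite m0 /=.
case: (leqP m n) => // lt; case/orP=> [-> //|/andP[m1 /andP[_ c]]].
by apply/orP; left; rewrite -/(dcls n p) dp; apply: cls_lt c; rewrite prednK.
Qed.

Lemma cls_or_allL b k x p q :
  dcls n q -> cls b k (All x (Or p q)) -> cls b k (Or (All x p) q).
Proof.
move=> dq; apply: (@cls_Qu_intro b false) => m m0 /=.
rewrite m0 /= -!/(dcls n _); case: (leqP m n) => // lt; rewrite dq /=.
case/or3P=> [/andP[-> _]//|/andP[/(dcls_lt false lt)-> _]//|].
case/andP=> m1 /orP[/andP[]|/andP[]] c _;
  have -> // : cls false m p by apply: cls_lt c; lia.
Qed.

Lemma cls_or_allR b k x p q :
  dcls n p -> cls b k (All x (Or p q)) -> cls b k (Or p (All x q)).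
Proof.
move=> dp; apply: (@cls_Qu_intro b false) => m m0 /=.
rewrite m0 /= -!/(dcls n _); case: (leqP m n) => // lt; rewrite dp /=.
case/or3P=> [/andP[_ /(dcls_lt false lt)->]|->|]; rewrite ?orbT //.
case/andP=> m1 /orP[/andP[]|/andP[]] _ c;
  (suff -> : cls false m q by rewrite orbT); apply: cls_lt c; lia.
Qed.

Lemma rule_cls b k p q :
  (forall r, proper_subformula r p -> prenex r) ->
  rule n p q -> cls b k q -> cls b k p.
Proof.
move=> sub r; case: r sub => {p q} [x xi d _|x xi d _ n0 U|x xi d _ C|x xi d _
  |x xi d _|x xi d _|x xi d _|x xi d _|x xi d _|x xi d _|x xi d _ C|x xi d _ C
  |x y xi _|x y xi _] sub.
- apply: (@cls_Qu_intro b false) => m m0 /=; rewrite m0 /=.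
  by case: (leqP m n).
- have /U_plus_cls[/(_ U) c _] : prenexb xi by apply/prenex_pren/sub; left; right; left.
  apply: (@cls_Qu_intro b true) => m m0 /=.
  rewrite m0 /= lt0n; case: eqP n0 => //= _ _.
  (* As [n] is positive, [All x xi] is in the universal class of level [n], which suffices for the
     premise of an existential implication above level [n]. *)
  case: (leqP m n) => // lt; rewrite c !orbT /= => h.
  suff -> : cls true m d by [].
  by case/orP: h => [//|/andP[_ /andP[_]]]; apply: cls_lt; rewrite prednK.
- have /C_plus_cls[/(_ C) c _] : prenexb d by apply/prenex_pren/sub; left; left.
  exact: cls_imp_exR.
- apply: (@cls_Qu_intro b false) => m m0 /=; rewrite m0 /=.
  by case: (leqP m n).
- by apply: (@cls_Qu_intro b true) => m m0 /=; rewrite m0.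
- by apply: (@cls_Qu_intro b false) => m m0 /=; rewrite m0.
- by apply: (@cls_Qu_intro b true) => m m0 /=; rewrite m0.
- by apply: (@cls_Qu_intro b false) => m m0 /=; rewrite m0.
- apply: (@cls_Qu_intro b true) => m m0 /=; rewrite m0 /=.
  by case: (leqP m n).
- apply: (@cls_Qu_intro b true) => m m0 /=; rewrite m0 /=.
  by case: (leqP m n).
- have /C_plus_cls[/(_ C) c _] : prenexb d by apply/prenex_pren/sub; right; left.
  exact: cls_or_allL.
- have /C_plus_cls[/(_ C) c _] : prenexb d by apply/prenex_pren/sub; left; left.
  exact: cls_or_allR.
- by case: b => /=; rewrite !cls_rename.
- by case: b => /=; rewrite !cls_rename.
Qed.

(** [cls] of a compound formula is a monotone combination of memberships of its operands, so the
    property of the rules passes to contexts. The combination mixes levels and polarities, hence the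
    induction over all [b] and [k]. *)
Lemma step_cls b k p q : step n p q -> cls b k q -> cls b k p.
Proof.
move=> st; elim: st b k => {p q} [p q sub r|p p' q _ IH|p q q' _ IH|p p' q _ IH
  |p q q' _ IH|p p' q _ IH|p q q' _ IH|x p p' _ IH|x p p' _ IH] b k /=.
- exact: rule_cls.
- by move=> /andP[/IH-> ->].
- by move=> /andP[-> /IH->].
- case: ifP => _; first by move=> /andP[/IH-> ->].
  case: b; first by case/orP=> /andP[/IH-> ->]; rewrite ?orbT.
  case/or3P=> [/andP[/IH-> ->]//|/andP[h ->]|/andP[-> /orP[]/andP[/IH-> ->]]];
    rewrite ?orbT //.
  by case/orP: h => /IH->; rewrite ?orbT.
- case: ifP => _; first by move=> /andP[-> /IH->].
  case: b; first by case/orP=> /andP[-> /IH->]; rewrite ?orbT.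
  case/or3P=> [/andP[-> h]|/andP[-> /IH->]|/andP[-> /orP[]/andP[-> /IH->]]];
    rewrite ?orbT //.
  by case/orP: h => /IH->; rewrite ?orbT.
- case: ifP => _; first by move=> /andP[/IH-> ->].
  case: b; last by move=> /andP[/IH-> ->].
  case/orP=> [/andP[h ->]|/andP[-> /andP[/IH-> ->]]]; rewrite ?orbT //.
  by case/orP: h => /IH->; rewrite ?orbT.
- case: ifP => _; first by move=> /andP[-> /IH->].
  case: b; last by move=> /andP[-> /IH->].
  by case/orP=> [/andP[-> /IH->]|/andP[-> /andP[-> /IH->]]]; rewrite ?orbT.
- by case: b => /andP[-> /IH].
- by case: b => /andP[-> /IH].
Qed.

Lemma steps_cls b k p q : steps n p q -> cls b k q -> cls b k p.
Proof.
by elim=> [{}p {}q /step_cls|//|{}p q1 {}q _ IH1 _ IH2 /IH2/IH1]; auto.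
Qed.

(** * Renaming, subformulas and congruence of [steps] *)

Lemma rename_pren x y p : prenexb (rename x y p) = prenexb p.
Proof.
have qfE q : qfree (rename x y q) = qfree q.
  by elim: q => //= [q1 -> q2 ->|q1 -> q2 ->|q1 -> q2 ->].
by elim: p => //= [p _ q _|p _ q _|p _ q _|z p IH|z p IH]; rewrite ?qfE //;
  case: eqP.
Qed.

Lemma qfree_sub q p : qfree p -> proper_subformula q p -> qfree q.
Proof.
by elim: p => //= p1 IH1 p2 IH2 /andP[q1 q2] [[->|/IH1]|[->|/IH2]]; auto.
Qed.

Lemma pren_sub q p : prenexb p -> proper_subformula q p -> prenexb q.
Proof.
elim: p => [r a||p1 _ p2 _|p1 _ p2 _|p1 _ p2 _|x p IH|x p IH];
  try by [move=> h /(qfree_sub h)/pren_qfree].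
  by move=> pp [->|/IH]; auto.
by move=> pp [->|/IH]; auto.
Qed.

Lemma fv_vars p : {subset fv p <= vars p}.
Proof.
move=> y; elim: p => //= [p IHp q IHq|p IHp q IHq|p IHp q IHq|x p IH|x p IH];
  rewrite ?mem_cat ?mem_filter ?inE.
1-3: by case/orP=> [/IHp|/IHq] ->; rewrite ?orbT.
all: by case/andP=> _ /IH ->; rewrite orbT.
Qed.

Lemma fresh_var (s : seq nat) : exists y, y \notin s.
Proof.
exists (\max_(z <- s) z).+1; apply/negP => h.
by have := @leq_bigmax_seq _ s xpredT id _ h isT; rewrite ltnn.
Qed.

Lemma steps_trans p q r : steps n p q -> steps n q r -> steps n p r.
Proof. exact: rt_trans. Qed.

Lemma steps_map (f : form L -> form L) p q :
  (forall p q, step n p q -> step n (f p) (f q)) ->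
  steps n p q -> steps n (f p) (f q).
Proof.
move=> H; elim=> [{}p {}q /H|{}p|{}p q1 {}q _ IH1 _ IH2].
- exact: rt_step.
- exact: rt_refl.
- exact: steps_trans IH1 IH2.
Qed.

(** * Pulling one quantifier out of a connective *)

Variant conn := CAnd | COr | CImp.

Definition bin c : form L -> form L -> form L :=
  match c with CAnd => @And L | COr => @Or L | CImp => @Imp L end.

(* The quantifier of the left operand that becomes one of polarity [b]. *)
Definition lpol c b := if c is CImp then ~~ b else b.

(* Side conditions of the rules pulling a quantifier of final polarity [b] out of
   the left operand [Qu (lpol c b) x p], resp. out of the right operand. *)
Definition okl c b p q :=
  match c with
  | CAnd => true
  | COr => b || dcls n q
  | CImp => ~~ b || (0 < n) && cls false n p
  end.

Definition okr c b p :=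
  match c with CAnd => true | COr => b || dcls n p | CImp => ~~ b || dcls n p end.

Lemma steps_bin c p p' q q' :
  steps n p p' -> steps n q q' -> steps n (bin c p q) (bin c p' q').
Proof.
move=> sp sq; apply: (@steps_trans _ (bin c p' q)).
  by apply: (@steps_map (fun r => bin c r q)) sp => r r'; case: c; constructor.
by apply: (@steps_map (bin c p')) sq => r r'; case: c; constructor.
Qed.

Lemma steps_Qu b x p q : steps n p q -> steps n (Qu b x p) (Qu b x q).
Proof. by apply: steps_map => r r'; case: b; constructor. Qed.

Lemma step_pren_var b x y p :
  prenexb p -> y \notin vars p -> steps n (Qu b x p) (Qu b y (rename x y p)).
Proof.
move=> pp fy; apply: rt_step; apply: step_here; last by case: b; constructor.
by move=> q sub; apply/prenex_pren; apply: pren_sub sub; rewrite pren_Qu.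
Qed.

Lemma step_pren_bin c p q r :
  prenexb p -> prenexb q -> rule n (bin c p q) r -> steps n (bin c p q) r.
Proof.
move=> pp pq hr; apply: rt_step; apply: step_here => // s sub; apply/prenex_pren.
by case: c hr sub => _ /= [[->|/pren_sub]|[->|/pren_sub]]; auto.
Qed.

(** The bound variable is first renamed to one fresh for both operands, which secures the variable
    condition of the pulling rule. *)
Lemma pull_left c b x p q : prenexb p -> prenexb q -> okl c b p q ->
  exists y, steps n (bin c (Qu (lpol c b) x p) q)
                    (Qu b y (bin c (rename x y p) q)).
Proof.
move=> pp pq ok; have [y] := fresh_var (vars p ++ vars q).
rewrite mem_cat negb_or => /andP[yp yq]; exists y.
have {}yq : y \notin fv q by apply: contra yq; apply: fv_vars.
apply: steps_trans (_ : steps n _ (bin c (Qu (lpol c b) y (rename x y p)) q)) _.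
  by apply: steps_bin; [apply: step_pren_var | apply: rt_refl].
apply: step_pren_bin => //; first by rewrite pren_Qu rename_pren.
case: c b ok => [] [] //= ok; constructor => //; try exact/C_plus_cls.
  by case: (n) ok.
by apply/U_plus_cls; rewrite ?rename_pren // cls_rename; case/andP: ok.
Qed.

Lemma pull_right c b x p q : prenexb p -> prenexb q -> okr c b p ->
  exists y, steps n (bin c p (Qu b x q)) (Qu b y (bin c p (rename x y q))).
Proof.
move=> pp pq ok; have [y] := fresh_var (vars p ++ vars q).
rewrite mem_cat negb_or => /andP[yp yq]; exists y.
have {}yp : y \notin fv p by apply: contra yp; apply: fv_vars.
apply: steps_trans (_ : steps n _ (bin c p (Qu b y (rename x y q)))) _.
  by apply: steps_bin; [apply: rt_refl | apply: step_pren_var].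
apply: step_pren_bin => //; first by rewrite pren_Qu rename_pren.
by case: c b ok => [] [] //= ok; constructor => //; exact/C_plus_cls.
Qed.

(** * Choosing the quantifier to pull *)

Lemma headP b p : prenexb p ->
  (exists x p1, p = Qu b x p1 /\ prenexb p1) \/
  (forall k, cls b k.+1 p -> cls (~~ b) k p).
Proof.
move=> /prenP[qp|[c [x [p1 [-> pp]]]]]; first by right=> k _; apply: cls_qfree.
have [<-|ne] := eqVneq c b; first by left; exists x, p1.
have -> : c = ~~ b by case: c b ne => [] [].
(* Under a head of polarity [~~ b], both memberships come down to the same condition on the body. *)
by right=> k; rewrite !cls_Qu eqxx; case: (b).
Qed.

(** The moves of [merge]: pulling stays in the class and shortens a prefix, dropping lowers the
    level. The operands are indices, so that case analysis rewrites them as quantified formulas. *)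
Variant level_spec c b k : form L -> form L -> Prop :=
| LevelLeft x p q of prenexb p & okl c b p q & cls b k.+1 (bin c p q) :
    level_spec c b k (Qu (lpol c b) x p) q
| LevelRight x p q of prenexb q & okr c b p & cls b k.+1 (bin c p q) :
    level_spec c b k p (Qu b x q)
| LevelDrop p q of cls (~~ b) k (bin c p q) : level_spec c b k p q.

Lemma level_and b k p q : prenexb p -> prenexb q ->
  cls b k.+1 (And p q) -> level_spec CAnd b k p q.
Proof.
move=> pp pq /= /andP[cp cq].
have [[x [p1 [E pp1]]]|hp] := headP b pp.
  subst p; apply: (@LevelLeft CAnd) => //.
  by move: cp; rewrite cls_Qu eqxx /= => ->.
have [[x [q1 [E pq1]]]|hq] := headP b pq.
  subst q; apply: (@LevelRight CAnd) => //.
  by move: cq; rewrite cls_Qu eqxx /= cp => ->.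
by apply: LevelDrop; rewrite /= hp ?hq.
Qed.

(** Existential quantifiers leave a disjunction unconditionally, so any existential head can be
    pulled; without one, both operands move to the opposite polarity one level down. [level_imp_U]
    is analogous. *)
Lemma level_or_E k p q : prenexb p -> prenexb q ->
  cls true k.+1 (Or p q) -> level_spec COr true k p q.
Proof.
move=> pp pq.
have [[x [p1 [E pp1]]]|hp] := headP true pp.
  by subst p => c; apply: (@LevelLeft COr).
have [[x [q1 [E pq1]]]|hq] := headP true pq.
  by subst q => c; apply: (@LevelRight COr).
move=> c; apply: LevelDrop; move: c; rewrite /=.
case: (leqP k.+1 n) => [lt /andP[/hp-> /hq->]|]; first by rewrite (ltnW lt).
rewrite ltnS leq_eqVlt => /orP[/eqP E|lt].
  by rewrite E leqnn orbb => /andP[/hp-> /hq->].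
by rewrite leqNgt lt /= => /orP[] /andP[/hp-> /hq->]; rewrite ?orbT.
Qed.

Lemma dcls_Qu b k x p : dcls k (Qu b x p) -> dcls k p.
Proof.
case/orP; rewrite cls_Qu; case: ifP => [/eqP->|_] /andP[_]; apply: dcls_le => //;
  exact: leq_pred.
Qed.

(** A universal quantifier leaves a disjunction only past a disjunct in [dcls n]. Up to level [n]
    both disjuncts qualify; above it the clause designates one, and the head of the other is tried
    first. *)
Lemma level_or_U k p q : prenexb p -> prenexb q ->
  cls false k.+1 (Or p q) -> level_spec COr false k p q.
Proof.
move=> pp pq; have hp' := headP false pp; have hq' := headP false pq.
rewrite /=; case: (leqP k.+1 n) => [lt /andP[cp cq]|gt].
  have dp := dcls_le lt cp; have dq := dcls_le lt cq.
  case: hp' => [[x [p1 [E pp1]]]|hp].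
    by subst p; apply: (@LevelLeft COr) => //; rewrite /= lt cq andbT.
  case: hq' => [[x [q1 [E pq1]]]|hq].
    by subst q; apply: (@LevelRight COr) => //; rewrite /= lt cp.
  by apply: LevelDrop; rewrite /= (ltnW lt) hp ?hq.
have nk : (k.+1 <= n) = false by rewrite leqNgt gt.
rewrite -!/(dcls n _) => /or3P[/andP[cp dq]|/andP[dp cq]|/andP[lt c]].
- case: hp' => [[x [p1 [E pp1]]]|hp].
    subst p; apply: (@LevelLeft COr) => //.
    by move: cp => /=; rewrite nk -!/(dcls n _) dq => ->.
  move: (gt); rewrite ltnS leq_eqVlt => /orP[/eqP E|lt]; last first.
    apply: LevelDrop.
    by rewrite /= leqNgt lt /= (hp _ cp) (dcls_lt true (ltnSn n) dq).
  (* At [k = n], dropping needs both disjuncts in the existential class of level [n]. A universal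
     head of [q] would obstruct this, but it can be pulled, since [p] has no such head and so lies
     in that class. *)
  subst k; case: hq' => [[x [q1 [E pq1]]]|hq].
    subst q; apply: (@LevelRight COr) => //=; first exact: dcls_le (hp _ cp).
    by rewrite nk -!/(dcls n _) cp (dcls_Qu dq).
  by apply: LevelDrop; rewrite /= leqnn hp // hq // (dcls_lt false gt dq).
- case: hq' => [[x [q1 [E pq1]]]|hq].
    subst q; apply: (@LevelRight COr) => //.
    by move: cq => /=; rewrite nk -!/(dcls n _) dp => ->; rewrite orbT.
  move: (gt); rewrite ltnS leq_eqVlt => /orP[/eqP E|lt]; last first.
    apply: LevelDrop.
    by rewrite /= leqNgt lt /= (hq _ cq) (dcls_lt true (ltnSn n) dp) orbT.
  subst k; case: hp' => [[x [p1 [E pp1]]]|hp].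
    subst p; apply: (@LevelLeft COr) => //=; first exact: dcls_le (hq _ cq).
    by rewrite nk -!/(dcls n _) cq (dcls_Qu dp) orbT.
  by apply: LevelDrop; rewrite /= leqnn hq // hp // (dcls_lt false gt dp).
- by apply: LevelDrop; move: c; rewrite /= leqNgt (lt : n < k).
Qed.

Lemma level_imp_E k p q : prenexb p -> prenexb q ->
  cls true k.+1 (Imp p q) -> level_spec CImp true k p q.
Proof.
move=> pp pq; have hp' := headP false pp; have hq' := headP true pq.
rewrite /=; case: (leqP k.+1 n) => [lt /andP[cp cq]|gt].
  case: hp' => [[x [p1 [E pp1]]]|hp].
    subst p; apply: (@LevelLeft CImp) => //=; last by rewrite lt cq andbT.
    exact: (cls_le lt cp).
  case: hq' => [[x [q1 [E pq1]]]|hq].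
    subst q; apply: (@LevelRight CImp) => //=; last by rewrite lt cp.
    exact: dcls_le lt cp.
  by apply: LevelDrop; rewrite /= (ltnW lt) hp ?hq.
have nk : (k.+1 <= n) = false by rewrite leqNgt gt.
rewrite -!/(dcls n _) => /orP[/andP[dp cq]|/and3P[lt cp cq]]; last first.
  by apply: LevelDrop; rewrite /= leqNgt (lt : n < k) /= cp.
case: hq' => [[x [q1 [E pq1]]]|hq].
  subst q; apply: (@LevelRight CImp) => //.
  by move: cq => /=; rewrite nk -!/(dcls n _) dp => ->.
case: hp' => [[x [p1 [E pp1]]]|hp].
  subst p; apply: (@LevelLeft CImp) => //=.
    (* A quantified premise in [dcls n] forces [0 < n], the proviso of [all_imp]. *)
    move: dp; rewrite /dcls /= => /orP[] /andP[n0 c]; last by rewrite n0.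
    by rewrite (ltnW n0) (cls_le (leq_pred n) c).
  by rewrite nk -!/(dcls n _) cq (dcls_Qu dp).
apply: LevelDrop; rewrite /=; case: (leqP k n) => le.
  by rewrite (hp _ (dcls_lt false gt dp)) hq.
by rewrite (dcls_lt true (ltnSn n) dp) hq.
Qed.

Lemma level_imp_U k p q : prenexb p -> prenexb q ->
  cls false k.+1 (Imp p q) -> level_spec CImp false k p q.
Proof.
move=> pp pq.
have [[x [p1 [E pp1]]]|hp] := headP true pp.
  by subst p => c; apply: (@LevelLeft CImp).
have [[x [q1 [E pq1]]]|hq] := headP false pq.
  by subst q => c; apply: (@LevelRight CImp).
move=> c; apply: LevelDrop; move: c; rewrite /=.
case: (leqP k.+1 n) => [lt /andP[/hp-> /hq->]|]; first by rewrite (ltnW lt).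
rewrite ltnS leq_eqVlt => /orP[/eqP E|lt].
  by rewrite E leqnn => /andP[/hp-> /hq->].
by rewrite leqNgt lt /= => /andP[/hp-> /hq->]; rewrite ?orbT.
Qed.

Lemma level_step c b k p q : prenexb p -> prenexb q ->
  cls b k.+1 (bin c p q) -> level_spec c b k p q.
Proof.
case: c b => [] [].
- exact: level_and.
- exact: level_and.
- exact: level_or_E.
- exact: level_or_U.
- exact: level_imp_E.
- exact: level_imp_U.
Qed.

(** * Reduction to prenex form *)

Fixpoint prefix_size p : nat :=
  match p with All _ p1 | Ex _ p1 => (prefix_size p1).+1 | _ => 0 end.

Lemma prefix_size_Qu b x p : prefix_size (Qu b x p) = (prefix_size p).+1.
Proof. by case: b. Qed.

Lemma prefix_size_rename x y p : prefix_size (rename x y p) = prefix_size p.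
Proof. by elim: p => //= z p IH; case: eqP => // _; rewrite IH. Qed.

Lemma cls_bin_rename c b k x y p q :
  cls b k (bin c (rename x y p) q) = cls b k (bin c p q) /\
  cls b k (bin c p (rename x y q)) = cls b k (bin c p q).
Proof. by case: c; rewrite /= !cls_rename. Qed.

Definition reducible b k p :=
  exists q, [/\ prenexb q, cls b k q & steps n p q].

(** The induction is on the two prefix sizes plus the level, one of which decreases with every move.
    It is not structural, because pulling renames inside the operand. *)
Lemma merge c b k p q : prenexb p -> prenexb q -> cls b k (bin c p q) ->
  reducible b k (bin c p q).
Proof.
move: {-1}(_ + k) (leqnn (prefix_size p + prefix_size q + k)) => N.
elim: N b k p q => [|N IH] b [|k] p q leN pp pq h; try by [rewrite addnS in leN];
  try by exists (bin c p q); split=> //;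
    [rewrite cls0 in h; apply: pren_qfree | apply: rt_refl].
have S := level_step pp pq h.
case: S leN pp pq {h} =>
  {p q} [x p1 q pp1 ok h1|x p q1 pq1 ok h1|p q h1] leN pp pq.
- rewrite prefix_size_Qu in leN.
  have [y st] := pull_left x pp1 pq ok.
  have [||||r [pr hr sr]] := IH b k.+1 (rename x y p1) q;
    rewrite ?prefix_size_rename ?rename_pren ?(cls_bin_rename _ _ _ _ _ _ _).1 //.
  exists (Qu b y r); split; rewrite ?pren_Qu ?cls_Qu ?eqxx //.
  by apply: steps_trans st _; apply: steps_Qu.
- rewrite prefix_size_Qu in leN.
  have [y st] := pull_right x pp pq1 ok.
  have [||||r [pr hr sr]] := IH b k.+1 p (rename x y q1);
    rewrite ?prefix_size_rename ?rename_pren ?(cls_bin_rename _ _ _ _ _ _ _).2 //.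
    by move: leN; lia.
  exists (Qu b y r); split; rewrite ?pren_Qu ?cls_Qu ?eqxx //.
  by apply: steps_trans st _; apply: steps_Qu.
- have [||||r [pr hr sr]] := IH (~~ b) k p q; rewrite ?addnS // in leN *.
  by exists r; split=> //; apply: clsS hr.
Qed.

Lemma reducible_bin c b k p p' q q' :
  prenexb p' -> prenexb q' -> steps n p p' -> steps n q q' ->
  cls b k (bin c p' q') -> reducible b k (bin c p q).
Proof.
move=> pp pq sp sq /(merge pp pq)[r [pr hr sr]]; exists r; split=> //.
by apply: steps_trans sr; apply: steps_bin.
Qed.

Lemma reducible_Qu b k c x p :
  (forall b k, cls b k p -> reducible b k p) ->
  cls b k (Qu c x p) -> reducible b k (Qu c x p).
Proof.
move=> H; rewrite cls_Qu; case: eqP => E /andP[lt /H[q [pq hq sq]]];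
  exists (Qu c x q); rewrite pren_Qu cls_Qu;
  move/eqP: E; [move=> ->|move=> /negbTE ->];
  by rewrite lt hq; split=> //; apply: steps_Qu.
Qed.

(** Each alternative in [cls] assigns classes to the operands. They are reduced within these
    classes, so the alternative still holds for their prenex forms and [merge] applies. *)
Lemma cls_reducible b k p : cls b k p -> reducible b k p.
Proof.
elim: p b k => [r a||p IHp q IHq|p IHp q IHq|p IHp q IHq|x p IH|x p IH] b k.
- by move=> _; exists (Atom a); split=> //; apply: rt_refl.
- by move=> _; exists Bot; split=> //; apply: rt_refl.
- move=> /= /andP[/IHp[p' [pp hp sp]] /IHq[q' [pq hq sq]]].
  by apply: (reducible_bin (c := CAnd) pp pq) => //=; rewrite hp.
- have or_case b' m c1 m1 c2 m2 : cls c1 m1 p -> cls c2 m2 q ->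
      (forall p q, cls c1 m1 p -> cls c2 m2 q -> cls b' m (Or p q)) ->
      reducible b' m (Or p q).
    move=> /IHp[p' [pp hp sp]] /IHq[q' [pq hq sq]] H.
    by apply: (reducible_bin (c := COr) pp pq) => //; apply: H.
  have or_E m : n < m ->
      cls true m p && cls true n.+1 q || cls true n.+1 p && cls true m q ->
      reducible true m (Or p q).
    rewrite ltnNge => /negbTE nm /orP[] /andP[hp hq];
    by apply: or_case hp hq _ => p' q' /= -> ->; rewrite nm ?orbT.
  rewrite /=; case: (leqP k n) => [le /andP[hp hq]|lt].
    by apply: or_case hp hq _ => p' q' /= -> ->; rewrite le.
  case: b => /=; first exact: or_E.
  have nk : (k <= n) = false by rewrite leqNgt lt.
  case/or3P=> [/andP[hp /orP[] hq]|/andP[/orP[] hp hq]|/andP[lt' h]].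
  1-4: by apply: or_case hp hq _ => p' q' /= -> ->; rewrite nk ?orbT.
  (* The guarded alternative is the existential one at level [k.-1]: the reduction is done there and
     its result raised. *)
  have [|r [pr hr sr]] := or_E k.-1 _ h; first by case: (k) lt'.
  by exists r; split=> //; apply: cls_lt hr; case: (k) lt'.
- have imp_case b' m c1 m1 c2 m2 : cls c1 m1 p -> cls c2 m2 q ->
      (forall p q, cls c1 m1 p -> cls c2 m2 q -> cls b' m (Imp p q)) ->
      reducible b' m (Imp p q).
    move=> /IHp[p' [pp hp sp]] /IHq[q' [pq hq sq]] H.
    by apply: (reducible_bin (c := CImp) pp pq) => //; apply: H.
  rewrite /=; case: (leqP k n) => [le /andP[hp hq]|lt].
    by apply: imp_case hp hq _ => p' q' /= -> ->; rewrite le.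
  have nk : (k <= n) = false by rewrite leqNgt lt.
  case: b; last first.
    by move=> /andP[hp hq]; apply: imp_case hp hq _ => p' q' /= -> ->; rewrite nk.
  case/orP=> [/andP[/orP[] hp hq]|/and3P[lt' hp hq]];
    by apply: imp_case hp hq _ => p' q' /= -> ->; rewrite nk ?lt' ?orbT.
- by apply: (@reducible_Qu b k false).
- by apply: (@reducible_Qu b k true).
Qed.

End Classes.

Theorem theorem3p21 (L : signature) (k n : nat) (phi : form L) :
  (classE n k phi <-> exists psi : form L, Sigma_plus k psi /\ steps n phi psi) /\
  (classU n k phi <-> exists psi : form L, Pi_plus k psi /\ steps n phi psi).
Proof.
split; [rewrite classE_cls | rewrite classU_cls]; split.
- by move=> /cls_reducible[q [pq hq sq]]; exists q; split=> //;
    apply/(Sigma_plus_cls n); rewrite pq.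
- by move=> [q [/(Sigma_plus_cls n)/andP[_ hq] /steps_cls]]; apply.
- by move=> /cls_reducible[q [pq hq sq]]; exists q; split=> //;
    apply/(Pi_plus_cls n); rewrite pq.
- by move=> [q [/(Pi_plus_cls n)/andP[_ hq] /steps_cls]]; apply.
Qed.
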